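(* Let $X$ be a Tychonoff space that is Ascoli and $\sigma$-compact. Then the free locally convex space $L(X)$ has a $\mathfrak{G}$-base if and only if $X$ admits an Ascoli uniformity $\mathcal{U}$ with a $\mathfrak{G}$-base.
   Context: $\mathbb{N}^{\mathbb{N}}$ is ordered coordinatewise: $\alpha\le\beta$ iff $\alpha(n)\le\beta(n)$ for all $n\in\mathbb{N}$. $\mathfrak{G}$-base: a topological space $Z$ has a $\mathfrak{G}$-base at $z\in Z$ if it has a base $\{U_\alpha:\alpha\in\mathbb{N}^{\mathbb{N}}\}$ of neighborhoods at $z$ such that $U_\beta\subseteq U_\alpha$ whenever $\alpha\le\beta$; $Z$ has a $\mathfrak{G}$-base if it has one at each of its points. A uniformity $\mathcal{U}$ has a $\mathfrak{G}$-base if it has a base $\{U_\alpha:\alpha\in\mathbb{N}^{\mathbb{N}}\}$ of entourages with $U_\beta\subseteq U_\alpha$ whenever $\alpha\le\beta$. Free locally convex space: $L(X)$ is a (real, Hausdorff) locally convex space together with a continuous map $i:X\to L(X)$ such that for every continuous map $f$ from $X$ to a locally convex space $E$ there is a unique continuous linear operator $\bar f:L(X)\to E$ with $f=\bar f\circ i$. It exists and is unique up to isomorphism. $C_k(X)$ is the space $C(X)$ of all continuous real-valued functions on $X$ with the compact-open topology. $X$ is an Ascoli space if every compact subset $\mathcal{K}$ of $C_k(X)$ is evenly continuous, i.e. the map $\mathcal{K}\times X\to\mathbb{R}$, $(f,x)\mapsto f(x)$, is continuous. A uniformity $\mathcal{U}$ on $X$ is Ascoli if it is admissible (it induces the topology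 of $X$) and every compact subset $K$ of $C_k(X)$ is uniformly equicontinuous with respect to $\mathcal{U}$, i.e. for every $\varepsilon>0$ there is $U\in\mathcal{U}$ such that $|f(x)-f(y)|<\varepsilon$ for every $f\in K$ and each $(x,y)\in U$. *)

(* Defs.v *)
From HB Require Import structures.
From mathcomp Require Import all_boot all_order all_algebra.
From mathcomp Require Import boolp classical_sets functions reals.
From mathcomp Require Import filter topology normedtype.

Set Implicit Arguments.
Unset Strict Implicit.
Unset Printing Implicit Defensive.

Import Order.TTheory GRing.Theory Num.Theory.
Import numFieldNormedType.Exports.

Local Open Scope classical_set_scope.
Local Open Scope ring_scope.

(* [F = filter_from setT U] says that the sets [U a] belong to the filter [F] and
   that every member of [F] contains one of them. *)
Definition G_base {T : Type} (F : set_system T) : Prop :=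
  exists U : (nat -> nat) -> set T,
    F = filter_from [set: nat -> nat] U /\
    forall a b : nat -> nat, (forall n, (a n <= b n)%N) -> U b `<=` U a.

Definition has_G_base (Z : topologicalType) : Prop :=
  forall z : Z, G_base (nbhs z).

Definition tychonoff_space (X : topologicalType) : Prop :=
  hausdorff_space X /\ completely_regular_space X.

Definition sigma_compact_space (X : topologicalType) : Prop :=
  exists2 K : nat -> set X, (forall n, compact (K n)) &
    \bigcup_n K n = [set: X].

(* Over a real field, a [tvsType] is by definition locally convex. The library
   does not require Hausdorffness, which is part of the notion of locally convex
   space here, for [L] as well as for the test spaces [E]. The uniform structure
   carried by a [tvsType] plays no role: only its topology is used. *)
Definition free_lcs (R : realType) (X : topologicalType)
    (L : tvsType R) (i : X -> L) : Prop :=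
  [/\ hausdorff_space L,
      continuous i &
      forall (E : tvsType R) (f : X -> E), hausdorff_space E -> continuous f ->
        exists! g : L -> E, [/\ linear g, continuous g & f = g \o i]].

Section Ck.
Import ArrowAsCompactOpen.

(* The subspace topology inherited from [{compact-open, X -> R}]. *)
Definition Ck (R : realType) (X : topologicalType) : topologicalType :=
  continuousType X R.

Definition evenly_continuous (R : realType) (X : topologicalType)
    (K : set (Ck R X)) : Prop :=
  {within K `*` [set: X], continuous (eval : Ck R X * X -> R)}.

End Ck.

Definition ascoli_space (R : realType) (X : topologicalType) : Prop :=
  forall K : set (Ck R X), compact K -> evenly_continuous K.

(* The axioms of [uniformType], as a predicate on the set of entourages, so that
   one can quantify over the uniformities on a given space. *)
Record uniformity (T : Type) (U : set_system (T * T)) : Prop := Uniformity {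
  uniformity_filter : Filter U ;
  uniformity_diagonal : forall A, U A -> diagonal `<=` A ;
  uniformity_inv : forall A, U A -> U (A^-1)%relation ;
  uniformity_split_ex :
    forall A, U A -> exists2 B, U B & (B \; B)%relation `<=` A
}.

(* [nbhs = nbhs_ U] is admissibility: [U] induces the topology of [X]. *)
Definition ascoli_uniformity (R : realType) (X : topologicalType)
    (U : set_system (X * X)) : Prop :=
  [/\ uniformity U,
      nbhs = nbhs_ U &
      forall K : set (Ck R X), compact K -> forall e : R, 0 < e ->
        exists2 A, U A & forall (f : continuousType X R) x y,
          K f -> A (x, y) -> `|f x - f y| < e].

(* Main.v *)
(**
The topology of [L(X)] is described by polars: for a pointwise bounded and
equicontinuous set [A] of functions on [X], the evaluation map from [X] to the
Banach space of bounded functions on [A] is continuous, and its extension to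
[L(X)] shows that the polar of [A] is a neighborhood of 0.

If [L(X)] has a G-base, the entourages [{(x, y) | i x - i y \in V}] form a
uniformity with a G-base; complete regularity makes it admissible, and since [X]
is Ascoli, a compact subset of [C_k(X)] is equicontinuous, so that its polar is a
possible [V].

Conversely let [(U_a)] be a G-base of an Ascoli uniformity and [(C_n)] a compact
cover. A sequence of elements of [nat -> nat] coded by a single [c] defines the set
[A_c] of the functions that vary by at most [1/(k+1)] on the [k]-th chosen
entourage and are bounded on [C_n] by the [n]-th chosen number. The polars of the
[A_c] are neighborhoods of 0 decreasing in [c]. If [V] is a neighborhood of 0 and
[p] the gauge of a smaller convex neighborhood, the functions on [X] dominated by
[p] form a compact subset of [C_k(X)] by Arzela-Ascoli, which lies in some [A_c];
by Hahn-Banach the polar of [A_c] is then contained in [V].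
*)

Require Import Defs.
From HB Require Import structures.
From mathcomp Require Import all_boot all_order all_algebra.
From mathcomp Require Import boolp classical_sets functions reals.
From mathcomp Require Import interval_inference.
From mathcomp Require Import filter topology normedtype convex.
From mathcomp Require Import ring lra.

Set Implicit Arguments.
Unset Strict Implicit.
Unset Printing Implicit Defensive.

Import Order.TTheory GRing.Theory Num.Theory.
Import numFieldNormedType.Exports.

Local Open Scope classical_set_scope.
Local Open Scope ring_scope.

(** * The Hahn-Banach theorem *)

Section HahnBanach.
Context {R : realType} {E : lmodType R}.
Implicit Types (p q : E -> R) (x y : E).

Definition sublinear q :=
  (forall x y, q (x + y) <= q x + q y) /\
  (forall t x, 0 <= t -> q (t *: x) = t * q x).

Lemma sublinear0 q : sublinear q -> q 0 = 0.
Proof. by move=> [_ qZ]; rewrite -(scale0r 0) qZ ?mul0r. Qed.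

Lemma sublinear_geN q x : sublinear q -> - q (- x) <= q x.
Proof.
move=> sq; have := sq.1 x (- x); rewrite subrr sublinear0//.
by rewrite -lerBlDr sub0r.
Qed.

(** The missing inequality [t * q x <= q (t *: x)] is the third hypothesis at [t^-1] and
    [t *: x]. *)
Lemma sublinear_le q :
  (forall x y, q (x + y) <= q x + q y) -> q 0 = 0 ->
  (forall t x, 0 < t -> q (t *: x) <= t * q x) -> sublinear q.
Proof.
move=> qD q0 qZ; split=> // t x; rewrite le_eqVlt => /predU1P[<-|t0].
  by rewrite scale0r mul0r.
apply/eqP; rewrite eq_le qZ//= -ler_pdivlMl//.
by rewrite -{1}(scale1r x) -(mulVf (lt0r_neq0 t0)) -scalerA qZ// invr_gt0.
Qed.

Lemma le_infD (A B : set R) (a : R) : A !=set0 -> B !=set0 ->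
  (forall b c, A b -> B c -> a <= b + c) -> a <= inf A + inf B.
Proof.
move=> A0 B0 aAB; rewrite -lerBlDr; apply: (lb_le_inf A0) => b Ab.
rewrite lerBlDr -lerBlDl; apply: (lb_le_inf B0) => c Bc.
by rewrite lerBlDl; exact: aAB.
Qed.

(** This supplies the bounds of chains for Zorn's lemma. Each [q x] is at least [- p (- x)], so the
    infimum is finite; for subadditivity, the smaller of two comparable members serves at both
    points. *)
Lemma sublinear_inf_chain p (C : set (E -> R)) : C !=set0 ->
  (forall q, C q -> sublinear q /\ forall x, q x <= p x) ->
  (forall q r, C q -> C r -> (forall x, q x <= r x) \/ (forall x, r x <= q x)) ->
  let m x := inf [set q x | q in C] in
  sublinear m /\ forall q, C q -> forall x, m x <= q x.
Proof.
move=> [q0 Cq0] Csub Ctot m.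
have n0 x : [set q x | q in C] !=set0 by exists (q0 x), q0.
have lb x q : C q -> m x <= q x.
  move=> Cq; apply: ge_inf; last by exists q.
  exists (- p (- x)) => _ [r Cr <-]; have [sr rp] := Csub _ Cr.
  by apply: le_trans (sublinear_geN x sr); rewrite lerN2.
split; last by move=> q Cq x; exact: lb.
apply: sublinear_le => [x y||t x t0].
- apply: le_infD => // _ _ [q Cq <-] [r Cr <-].
  have [qr|rq] := Ctot _ _ Cq Cr.
    apply: (le_trans (lb _ _ Cq)).
    by rewrite (le_trans ((Csub _ Cq).1.1 _ _))// lerD.
  apply: (le_trans (lb _ _ Cr)).
  by rewrite (le_trans ((Csub _ Cr).1.1 _ _))// lerD.
- apply/eqP; rewrite eq_le; apply/andP; split.
    by apply: (le_trans (lb _ _ Cq0)); rewrite sublinear0//; exact: (Csub _ Cq0).1.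
  apply: lb_le_inf => // _ [q Cq <-].
  by rewrite sublinear0//; exact: (Csub _ Cq).1.
- rewrite -ler_pdivrMl//; apply: lb_le_inf => // _ [q Cq <-].
  by rewrite ler_pdivrMl// (le_trans (lb _ _ Cq))// (Csub _ Cq).1.2// ltW.
Qed.

(** The standard way to lower a sublinear [q] towards linearity along [y]: the choice [t = 1] at
    [- y] gives [tilt q y (- y) <= - q y]. *)
Definition tilt q y x :=
  inf [set q (x + t *: y) - t * q y | t in [set t | 0 <= t]].

Lemma tilt_le q y t x : sublinear q -> 0 <= t ->
  tilt q y x <= q (x + t *: y) - t * q y.
Proof.
move=> sq t0; apply: ge_inf; last by exists t.
(* A lower bound, since [q (s *: y) <= q (x + s *: y) + q (- x)]. *)
exists (- q (- x)) => _ [s /= s0 <-].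
rewrite lerBrDl -sq.2// lerBlDr.
by rewrite (le_trans _ (sq.1 _ _))// addrAC subrr add0r.
Qed.

Lemma tilt_neq0 q y x :
  [set q (x + t *: y) - t * q y | t in [set t | 0 <= t]] !=set0.
Proof. by exists (q (x + 0 *: y) - 0 * q y), 0 => /=. Qed.

Lemma tilt_le_self q y x : sublinear q -> tilt q y x <= q x.
Proof.
move=> sq; rewrite (le_trans (tilt_le _ _ sq (lexx 0)))//.
by rewrite scale0r addr0 mul0r subr0.
Qed.

(** Parameters [s] at [x] and [t] at [z] combine to [s + t] at [x + z], and [s] at [x] becomes
    [u * s] at [u *: x]. *)
Lemma sublinear_tilt q y : sublinear q -> sublinear (tilt q y).
Proof.
move=> sq; apply: sublinear_le => [x z||u x u0].
- apply: le_infD; [exact: tilt_neq0..|].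
  move=> _ _ [s /= s0 <-] [t /= t0 <-].
  rewrite (le_trans (tilt_le _ _ sq (addr_ge0 s0 t0)))//.
  rewrite scalerDl addrACA mulrDl.
  have := sq.1 (x + s *: y) (z + t *: y); lra.
- apply/eqP; rewrite eq_le; apply/andP; split.
    by rewrite (le_trans (tilt_le_self _ _ sq))// sublinear0.
  apply: lb_le_inf; first exact: tilt_neq0.
  by move=> _ [s /= s0 <-]; rewrite add0r sq.2// subrr.
- rewrite -ler_pdivrMl//; apply: lb_le_inf; first exact: tilt_neq0.
  move=> _ [s /= s0 <-]; rewrite ler_pdivrMl//.
  have us0 : 0 <= u * s by rewrite mulr_ge0// ltW.
  rewrite (le_trans (tilt_le _ _ sq us0))//.
  by rewrite -scalerA -scalerDr sq.2 ?(ltW u0)// mulrBr mulrA.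
Qed.

Lemma minimal_sublinear p : sublinear p ->
  exists q, [/\ sublinear q, forall x, q x <= p x &
    forall r, sublinear r -> (forall x, r x <= q x) -> r = q].
Proof.
move=> sp; pose T := {q : E -> R | sublinear q /\ forall x, q x <= p x}.
(* The order is reversed, so that a maximal element for Zorn's lemma is pointwise minimal. *)
pose rT (q r : T) := `[< forall x, sval r x <= sval q x >].
have [||||[q [sq qp]] qmin] := @Zorn T rT.
- by move=> q; apply/asboolP.
- move=> q r s /asboolP qr /asboolP rs; apply/asboolP => x.
  exact: le_trans (rs x) (qr x).
- move=> q r /asboolP qr /asboolP rq; apply: eq_sig_hprop => [?|].
    exact: Prop_irrelevance.
  apply/funext => x.
  by apply/eqP; rewrite eq_le rq qr.
- move=> A Atot; have [->|/set0P[[q0 q0P] Aq0]] := eqVneq A set0.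
    by exists (exist _ p (conj sp (fun x => lexx _))).
  pose C := [set sval q | q in A].
  have [||q r [a Aa <-] [b Ab <-]|sm mC] := @sublinear_inf_chain p C.
  + by exists q0, (exist _ q0 q0P).
  + by move=> _ [[q qP] _ <-].
  + by case: (Atot a b Aa Ab) => /asboolP; [right|left].
  + have mp x : inf [set q x | q in C] <= p x.
      apply: (le_trans (mC q0 _ x)); last exact: q0P.2.
      by exists (exist _ q0 q0P).
    pose m : T := exist _ (fun x => inf [set q x | q in C]) (conj sm mp).
    exists m => q Aq; apply/asboolP => x /=.
    by apply: mC; exists q.
exists q; split=> // r sr rq.
have rp x : r x <= p x := le_trans (rq x) (qp x).
have /qmin /(congr1 sval)//: rT (exist _ q (conj sq qp)) (exist _ r (conj sr rp)).
by apply/asboolP.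
Qed.

(* A minimal sublinear [q] equals each [tilt q y], whose value at [x] is at most
   [q (x + y) - q y]; hence [q] is superadditive. *)
Lemma minimal_sublinear_linear q : sublinear q ->
  (forall r, sublinear r -> (forall x, r x <= q x) -> r = q) ->
  linear (q : E -> R^o).
Proof.
move=> sq qmin.
have qD x y : q (x + y) = q x + q y.
  have qy : tilt q y = q.
    by apply: qmin; [exact: sublinear_tilt|move=> z; exact: tilt_le_self].
  apply/eqP; rewrite eq_le sq.1 -lerBrDr/= -{1}qy.
  by rewrite (le_trans (tilt_le _ _ sq ler01))// scale1r mul1r.
have qN x : q (- x) = - q x.
  by apply/eqP; rewrite eq_sym -subr_eq0 -opprD oppr_eq0 -qD subrr sublinear0.
move=> a x y; rewrite qD; congr (_ + _).
have [a0|a0] := leP 0 a; first exact: sq.2.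
rewrite -[a]opprK scaleNr qN sq.2 ?oppr_ge0 ?ltW//.
by rewrite [RHS]mulNr.
Qed.

(** Minimizing below [tilt p x0] instead of [p] fixes the value at [x0]: then
    [- g x0 <= g (- x0) <= - p x0]. *)
Theorem hahn_banach p x0 : sublinear p ->
  exists g : E -> R^o, [/\ linear g, forall x, g x <= p x & g x0 = p x0].
Proof.
move=> sp; have [g [sg gp gmin]] := minimal_sublinear (sublinear_tilt x0 sp).
have gle x : g x <= p x := le_trans (gp x) (tilt_le_self _ _ sp).
exists g; split=> //; first exact: minimal_sublinear_linear.
apply/eqP; rewrite eq_le gle/=.
have := le_trans (sublinear_geN (- x0) sg) (gp _).
move=> /le_trans/(_ (tilt_le _ _ sp ler01)).
by rewrite opprK scale1r addNr (sublinear0 sp) mul1r sub0r lerN2.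
Qed.

End HahnBanach.

(** * The gauge of a convex neighborhood *)

Section Gauge.
Context {R : realType} {L : tvsType R}.

Lemma convex_setP (M : lmodType R) (B : set M) (x y : M) (k : R) :
  convex_set B -> B x -> B y -> 0 <= k <= 1 -> B (k *: x + (1 - k) *: y).
Proof.
move=> cB Bx By k01; have := cB x y (Itv01 (andP k01).1 (andP k01).2).
by rewrite !inE; apply.
Qed.

Definition gauge (B : set L) (x : L) := inf [set t | 0 < t /\ B (t^-1 *: x)].

Section GaugeOfNbhs.
Variable B : set L.
Hypotheses (cB : convex_set B) (nB : nbhs 0 B).

Let B0 : B 0. Proof. exact: nbhs_singleton. Qed.

Lemma gauge_le t x : 0 < t -> B (t^-1 *: x) -> gauge B x <= t.
Proof. by move=> t0 Bx; apply: ge_inf => //; exists 0 => s [/ltW]. Qed.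

(** By continuity of scaling at [(0, x)], a small positive multiple of [x] lies in [B]. *)
Lemma absorbing_neq0 x : [set t | 0 < t /\ B (t^-1 *: x)] !=set0.
Proof.
have /= := @scale_continuous R L (0, x) B; rewrite scale0r => /(_ nB).
move=> [[U W] [/= /nbhs_ballP[e /= e0 eU] Wx] UWB]; exists (e / 2)^-1.
split; first by rewrite invr_gt0 divr_gt0.
rewrite invrK; apply: (UWB (e / 2, x)); split; last exact: nbhs_singleton.
apply: eU.
rewrite -ball_normE /= sub0r normrN gtr0_norm ?divr_gt0//.
by rewrite ltr_pdivrMr// ltr_pMr// ltr1n.
Qed.

Lemma gauge_lt1 x : gauge B x < 1 -> B x.
Proof.
move=> /(inf_lt (absorbing_neq0 x))[t [t0 Btx] t1].
(* [x] is the convex combination of [t^-1 *: x] and 0 with weights [t] and [1 - t]. *)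
have := convex_setP cB Btx B0 (k := t); rewrite !ltW// => /(_ isT).
by rewrite scaler0 addr0 scalerA divff ?scale1r// gt_eqF.
Qed.

(** The neighborhood is [B] scaled by [e / 2], the half making the inequality strict. *)
Lemma gauge_lt_near e : 0 < e -> \forall x \near 0, gauge B x < e.
Proof.
move=> e0; have e20 : 0 < e / 2 by rewrite divr_gt0.
have := nbhs0Z (lt0r_neq0 e20) nB; apply: filterS => _ [b Bb <-].
rewrite (@le_lt_trans _ _ (e / 2))//; last first.
  by rewrite ltr_pdivrMr// ltr_pMr// ltr1n.
by apply: gauge_le => //; rewrite scalerA mulVf ?scale1r// gt_eqF.
Qed.

Lemma gauge_sublinear : sublinear (gauge B).
Proof.
apply: sublinear_le => [x y||t x t0].
- apply: le_infD; [exact: absorbing_neq0..|].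
  move=> s t [s0 Bs] [t0 Bt]; have st0 : 0 < s + t by rewrite addr_gt0.
  apply: gauge_le => //.
  have -> : (s + t)^-1 *: (x + y) =
      (s / (s + t)) *: (s^-1 *: x) + (1 - s / (s + t)) *: (t^-1 *: y).
    rewrite scalerDr !scalerA; congr (_ *: _ + _ *: _); field.
      by rewrite !gt_eqF.
    by rewrite !gt_eqF.
  apply: convex_setP => //; rewrite divr_ge0 ?(ltW s0, ltW st0)//=.
  by rewrite ler_pdivrMr// mul1r lerDl ltW.
- apply/eqP; rewrite eq_le; apply/andP; split.
    apply/ler_addgt0Pl => e e0; rewrite addr0.
    by apply: gauge_le => //; rewrite scaler0.
  by apply: lb_le_inf; [exact: absorbing_neq0|move=> t [/ltW]].
- rewrite -ler_pdivrMl//; apply: lb_le_inf; first exact: absorbing_neq0.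
  move=> s [s0 Bs]; rewrite ler_pdivrMl//.
  apply: gauge_le; first by rewrite mulr_gt0.
  by rewrite invfM mulrC scalerA -mulrA mulVf ?mulr1// gt_eqF.
Qed.

End GaugeOfNbhs.

Lemma nbhs0_sublinear (V : set L) : nbhs 0 V -> exists p : L -> R,
  [/\ sublinear p, forall e, 0 < e -> \forall x \near 0, p x < e &
      forall x, p x < 1 -> V x].
Proof.
move=> nV; have [BB convB [openB basisB]] := @locally_convex R L.
have [B [BB_B B0] BV] := basisB 0 V nV.
have nB : nbhs 0 B by apply: open_nbhs_nbhs; split => //; exact: openB.
have cB : convex_set B by apply: convB; rewrite inE.
exists (gauge B); split.
- exact: gauge_sublinear.
- exact: gauge_lt_near.
- by move=> x /(gauge_lt1 cB nB)/BV.
Qed.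

End Gauge.

(** * The normed space of bounded functions *)

Section BoundedFunctions.
Context (R : realType) (T : Type).

Definition bounded_on : {pred T -> R} :=
  [pred f | `[< exists M, forall t, `|f t| <= M >]].

Lemma bounded_onP f :
  reflect (exists M, forall t, `|f t| <= M) (f \in bounded_on).
Proof. exact: asboolP. Qed.

Lemma bounded_on_submod : submod_closed bounded_on.
Proof.
split; first by apply/bounded_onP; exists 0 => t; rewrite normr0.
move=> a f g /bounded_onP[M fM] /bounded_onP[N gN]; apply/bounded_onP.
exists (`|a| * M + N) => t; rewrite (le_trans (ler_normD _ _))// lerD//.
by rewrite normrM ler_wpM2l.
Qed.

HB.instance Definition _ :=
  GRing.isSubmodClosed.Build R (T -> R) bounded_on bounded_on_submod.

Record linf := Linf { linf_fun :> T -> R; _ : linf_fun \in bounded_on }.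

HB.instance Definition _ := [isSub for linf_fun].
HB.instance Definition _ := [Choice of linf by <:].
HB.instance Definition _ := [SubChoice_isSubLmodule of linf by <:].

Definition linf_norm (f : linf) : R := sup [set `|f t| | t in [set: T]].

Lemma linf_norm_ge (f : linf) t : `|f t| <= linf_norm f.
Proof.
apply: ub_le_sup; last by exists t.
by case: f => f /bounded_onP[M fM] /=; exists M => _ [u _ <-] /=.
Qed.

Lemma linf_norm_le (f : linf) M :
  0 <= M -> (forall t, `|f t| <= M) -> linf_norm f <= M.
Proof.
move=> M0 fM; rewrite /linf_norm.
(* If [T] is empty, the supremum takes its default value 0. *)
have [->|/set0P A0] := eqVneq [set `|f t| | t in [set: T]] set0.
  by rewrite sup0.
by apply: ge_sup => // _ [t _ <-].
Qed.

Lemma linf_norm_ge0 (f : linf) : 0 <= linf_norm f.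
Proof.
rewrite /linf_norm.
have [->|/set0P[_ [t _ _]]] := eqVneq [set `|f t| | t in [set: T]] set0.
  by rewrite sup0.
exact: le_trans (linf_norm_ge f t).
Qed.

Lemma linf_normD (f g : linf) : linf_norm (f + g) <= linf_norm f + linf_norm g.
Proof.
apply: linf_norm_le => [|t]; first by rewrite addr_ge0 ?linf_norm_ge0.
by rewrite (le_trans (ler_normD _ _))// lerD ?linf_norm_ge.
Qed.

Lemma linf_normZ (a : R) (f : linf) : linf_norm (a *: f) = `|a| * linf_norm f.
Proof.
have le b (g : linf) : linf_norm (b *: g) <= `|b| * linf_norm g.
  apply: linf_norm_le => [|t]; first by rewrite mulr_ge0 ?linf_norm_ge0.
  by rewrite normrM ler_wpM2l ?linf_norm_ge.
apply/eqP; rewrite eq_le le/=.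
have [->|a0] := eqVneq a 0; first by rewrite normr0 mul0r linf_norm_ge0.
rewrite -ler_pdivlMl ?normr_gt0// -normfV.
by rewrite -{1}(scale1r f) -(mulVf a0) -scalerA le.
Qed.

Lemma linf_norm_eq0 (f : linf) : linf_norm f = 0 -> f = 0.
Proof.
move=> f0; apply/val_inj/funext => t /=.
by apply/eqP; rewrite -normr_le0 -f0 linf_norm_ge.
Qed.

HB.instance Definition _ :=
  Lmodule_isNormed.Build R linf linf_normD linf_normZ linf_norm_eq0.

Lemma linf_eval_le_norm (f : linf) t : `|f t| <= `|f|.
Proof. exact: linf_norm_ge. Qed.

Lemma linf_eval_continuous (t : T) :
  continuous ((fun f : linf => f t) : linf -> R^o).
Proof.
move=> f; have FF : Filter (nbhs f) := nbhs_filter f.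
apply/cvgrPdist_lt => e e0.
apply: filterS (nbhsx_ballx f e e0) => g; rewrite -ball_normE.
apply: le_lt_trans.
exact: (linf_eval_le_norm (f - g) t).
Qed.

End BoundedFunctions.

(** * Polars in the free locally convex space *)

Section LinearFunction.
Context {R : pzRingType} {E F : lmodType R} {g : E -> F} (lg : linear g).

Lemma linear_fun0 : g 0 = 0.
Proof. by have := lg (-1) 0 0; rewrite scaler0 addr0 scaleN1r addNr. Qed.

Lemma linear_funB x y : g (x - y) = g x - g y.
Proof. by rewrite addrC -scaleN1r lg scaleN1r addrC. Qed.

End LinearFunction.

Lemma nbhs0_subl {R : numFieldType} {L : tvsType R} (z : L) (V : set L) :
  nbhs 0 V -> \forall c \near z, V (z - c).
Proof.
move=> nV; apply: filterS (nbhsT z (nbhs0N nV)) => c [_ [v Vv <-] <-].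
by rewrite opprB addrC subrK.
Qed.

(** Functionals on [L] are tested through their restrictions along [i], so [A] can be a set of
    functions on [X]. *)
Definition polar {R : realType} {X : Type} {L : tvsType R} (i : X -> L)
    (A : set (X -> R)) (e : R) : set L :=
  [set c | forall g : L -> R^o, linear g -> continuous g -> A (g \o i) ->
    `|g c| < e].

Section FreeLCS.
Context {R : realType} {X : topologicalType} {L : tvsType R} {i : X -> L}.
Hypothesis freeL : free_lcs i.

Lemma free_lcs_ext (E : tvsType R) (g h : L -> E) : hausdorff_space E ->
  linear g -> continuous g -> linear h -> continuous h ->
  g \o i = h \o i -> g = h.
Proof.
move=> hE lg cg lh ch gh; have [_ ci univ] := freeL.
have cgi : continuous (g \o i).
  by move=> x; apply: continuous_comp; [exact: ci|exact: cg].
have [k [_ uk]] := univ E (g \o i) hE cgi.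
by rewrite -(uk g)// -(uk h).
Qed.

Lemma free_lcs_extend (f : X -> R) : continuous f ->
  exists g : L -> R^o, [/\ linear g, continuous g & forall x, g (i x) = f x].
Proof.
move=> cf; have [_ _ univ] := freeL.
have [g [[lg cg fg] _]] := univ R^o f (@Rhausdorff R) cf.
by exists g; split=> // x; rewrite fg.
Qed.

(* The evaluation map from [X] to the bounded functions on [A] is continuous, and
   its extension to [L] has the maps [g] as coordinates. *)
Lemma polar_nbhs (A : set (X -> R)) (e : R) :
  (forall x, exists M, forall f, A f -> `|f x| <= M) ->
  (forall x d, 0 < d -> \forall y \near x, forall f, A f -> `|f x - f y| <= d) ->
  0 < e -> nbhs 0 (polar i A e).
Proof.
move=> bA eA e0; have [_ ci univ] := freeL.
pose T := {f | A f}.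
have bnd x : (fun t : T => sval t x) \in @bounded_on R T.
  by apply/bounded_onP; have [M AM] := bA x; exists M => -[f Af] /=; exact: AM.
pose phi x : linf R T := Linf (bnd x).
have cphi : continuous phi.
  move=> x; apply/cvgrPdist_le => d d0; have := eA x d d0.
  apply: filterS => y Axy; apply: linf_norm_le; first exact: ltW.
  by move=> [f Af]; exact: Axy.
have [G [[lG cG phiG] _]] := univ (linf R T) phi (@norm_hausdorff _ _) cphi.
have : \forall c \near 0, `|G c| < e.
  have Gball : nbhs 0 (G @^-1` ball (G 0) e) := cG 0 _ (nbhsx_ballx _ _ e0).
  apply: filterS Gball => c.
  by rewrite -ball_normE /= (linear_fun0 lG) sub0r normrN.
apply: filterS => c Gce g lg cg Ag.
pose t : T := exist _ _ Ag.
suff -> : g = (fun c => G c t) :> (L -> R^o).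
  exact: le_lt_trans (linf_eval_le_norm (G c) t) Gce.
apply: (@free_lcs_ext R^o) => //.
- by move=> a u v; rewrite lG.
- by move=> u W nW; exact: (cG u _ (linf_eval_continuous nW)).
- by apply/funext => x; rewrite /= -[G (i x)]/((G \o i) x) -phiG.
Qed.

End FreeLCS.

(** * The uniformity induced by [L] *)

Section CompactInCk.
Context {R : realType} {X : topologicalType} (K : set (Ck R X)).
Hypotheses (cK : compact K) (eK : evenly_continuous K).

Lemma evenly_continuous_near (f : Ck R X) x (e : R) : K f -> 0 < e ->
  \forall g \near f & y \near x, K g ->
    `|(f : continuousType X R) x - (g : continuousType X R) y| < e.
Proof.
move=> Kf e0; have /subspace_continuousP/(_ (f, x)) := eK.
move=> /(_ (conj Kf I)) /cvgrPdist_lt /(_ e e0).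
rewrite near_withinE => -[[U V] [/= nU nV] UV].
exists (U, V) => // -[g y] [/= Ug Vy] Kg.
exact: (UV (g, y) (conj Ug Vy) (conj Kg I)).
Qed.

(** For [g] near a given [f] and [y] near [x], both [g x] and [g y] are within [e / 2] of [f x];
    compactness of [K] makes the neighborhood of [x] independent of [f]. *)
Lemma compact_Ck_equicontinuous x (e : R) : 0 < e ->
  \forall y \near x, forall f : continuousType X R, K f -> `|f x - f y| <= e.
Proof.
move=> e0; have e20 : 0 < e / 2 by rewrite divr_gt0.
move/compact_near_coveringP/near_covering_withinP : cK => covK.
apply: (covK _ _ (fun y (f : continuousType X R) => `|f x - f y| <= e)) => f Kf.
have [[U V] [/= nU nV] UV] := evenly_continuous_near x Kf e20.
exists (U, V) => // -[g y] [/= Ug Vy] Kg.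
have gy := UV (g, y) (conj Ug Vy) Kg.
have gx := UV (g, x) (conj Ug (nbhs_singleton nV)) Kg.
rewrite /= in gx gy.
rewrite ltW// (splitr e).
by rewrite (le_lt_trans (ler_distD ((f : continuousType X R) x) _ _))// distrC ltrD.
Qed.

Lemma compact_Ck_bounded x :
  exists M : R, forall f : continuousType X R, K f -> `|f x| <= M.
Proof.
move/compact_near_coveringP/near_covering_withinP : cK => covK.
have : \forall M \near +oo_R,
    K `<=` [set f | `|(f : continuousType X R) x| <= M].
  apply: covK => f Kf.
  have [[U V] [/= nU nV] UV] := evenly_continuous_near x Kf ltr01.
  exists (U, [set M | `|(f : continuousType X R) x| + 1 <= M]) => /=.
    by split=> //; exact: nbhs_pinfty_ge.
  move=> [g M] [/= Ug fM] Kg; apply: le_trans fM.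
  have := UV (g, x) (conj Ug (nbhs_singleton nV)) Kg; rewrite /= => fg.
  rewrite -lerBlDl (le_trans _ (ltW fg))// distrC.
  exact: lerB_dist.
by move=> /filter_ex[M KM]; exists M => f /KM.
Qed.

End CompactInCk.

Section PullbackUniformity.
Context {R : realType} {X : topologicalType} {L : tvsType R} (i : X -> L).

Definition pullback_uniformity : set_system (X * X) :=
  [set A | exists2 V, nbhs (0 : L) V & forall x y, V (i x - i y) -> A (x, y)].

Lemma uniformity_pullback : uniformity pullback_uniformity.
Proof.
split.
- split.
  + by exists setT => //; exact: filterT.
  + move=> A B [V nV VA] [W nW WB]; exists (V `&` W); first exact: filterI.
    by move=> x y [/VA ? /WB].
  + by move=> A B AB [V nV VA]; exists V => // x y /VA/AB.
- move=> A [V nV VA] [x y] /diagonalP xy; rewrite {}xy; apply: VA.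
  by rewrite subrr; exact: nbhs_singleton.
- move=> A [V nV VA]; exists (-%R @` V); first exact: nbhs0N.
  by move=> x y [v Vv vE]; apply: VA; rewrite -opprB -vE opprK.
- move=> A [V nV VA]; have := @add_continuous L (0, 0) V.
  rewrite /= addr0 => /(_ nV) [[U W] [/= nU nW] UWV].
  exists [set xy | (U `&` W) (i xy.1 - i xy.2)].
    by exists (U `&` W) => //; exact: filterI.
  move=> [x y] [/= z [Uxz _] [_ Wzy]]; apply: VA.
  rewrite -(subrKA (i z)); exact: (UWV (i x - i z, i z - i y)).
Qed.

(** Continuity of [i] gives one inclusion. For the other, a function separating [x] from the
    complement of an open set extends to a functional [g], and [|g| < 1] defines the entourage. *)
Lemma nbhs_pullback_uniformity : free_lcs i -> completely_regular_space X ->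
  nbhs = nbhs_ pullback_uniformity.
Proof.
move=> freeL crX; have [_ ci _] := freeL.
apply/funext => x; apply/seteqP; split=> O.
- rewrite nbhsE => -[B [oB Bx] BO].
  have sepB : uniform_separator [set x] (~` B).
    by apply: crX; [exact: open_closedC|apply].
  have [f [cf _ f0 f1]] := (uniform_separatorP (R := R) _ _).1 sepB.
  have [g [lg cg gE]] := free_lcs_extend freeL cf.
  have gx : g (i x) = 0 by rewrite gE; apply: f0; exists x.
  exists [set xy | `|g (i xy.1 - i xy.2)| < 1].
    exists [set c | `|g c| < 1] => //.
    have gball : nbhs 0 (g @^-1` ball (g 0) 1) := cg 0 _ (nbhsx_ballx _ _ ltr01).
    apply: filterS gball => c.
    by rewrite -ball_normE /= (linear_fun0 lg) sub0r normrN.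
  move=> y /xsectionP /= gxy; apply: BO; apply: contrapT => nBy.
  have gy : g (i y) = 1 by rewrite gE; apply: f1; exists y.
  by move: gxy; rewrite (linear_funB lg) gx gy sub0r normrN normr1 ltxx.
- move=> [A [V nV VA] AO]; apply: filterS AO _.
  have nx : nbhs x (i @^-1` [set c | V (i x - c)]) := ci x _ (nbhs0_subl _ nV).
  by apply: filterS nx => y Vy; apply/xsectionP; exact: VA.
Qed.

End PullbackUniformity.

Lemma G_base_ascoli_uniformity (R : realType) (X : topologicalType)
    (L : tvsType R) (i : X -> L) :
  completely_regular_space X -> ascoli_space R X -> free_lcs i ->
  G_base (nbhs (0 : L)) ->
  ascoli_uniformity R (pullback_uniformity i) /\ G_base (pullback_uniformity i).
Proof.
move=> crX ascX freeL [B [nB Bmon]]; split.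
  split; [exact: uniformity_pullback|exact: nbhs_pullback_uniformity|].
  move=> K cK e e0; have eK := ascX K cK.
  pose A : set (X -> R) := [set f : X -> R |
    exists2 h : continuousType X R, K h & f = h].
  exists [set xy | polar i A e (i xy.1 - i xy.2)].
    exists (polar i A e) => //; apply: polar_nbhs => // [x|x d d0].
      have [M KM] := compact_Ck_bounded cK eK x.
      by exists M => _ [f Kf ->]; exact: KM.
    apply: filterS (compact_Ck_equicontinuous cK eK x d0) => y Ky _ [f Kf ->].
    exact: Ky.
  move=> f x y Kf pxy.
  (* With [g] extending [f], the difference [f x - f y] is [g (i x - i y)]. *)
  have [g [lg cg gE]] := free_lcs_extend freeL (@cts_fun _ _ f).
  have := pxy g lg cg; rewrite /= (linear_funB lg) !gE; apply.
  by exists f => //; apply/funext => z; rewrite /= gE.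
exists (fun a => [set xy | B a (i xy.1 - i xy.2)]); split; last first.
  by move=> a b ab [x y]; exact: Bmon.
rewrite /pullback_uniformity nB; apply/seteqP; split=> A.
  by move=> [V [a _ BV] VA]; exists a => // -[x y] /BV/VA.
by move=> [a _ BA]; exists (B a); [exists a|move=> x y Bxy; exact: BA].
Qed.

(** * Compactness in [Ck] from equicontinuity *)

Section CompactCk.
Context {R : realType} {X : topologicalType}.

Definition Ck_subset (W : set (X -> R)) : set (Ck R X) :=
  [set f : continuousType X R | W f].

(** Arzela-Ascoli gives compactness among all functions, for uniform convergence on compact sets;
    cluster points are continuous by equicontinuity, so they lie in [Ck R X]. *)
Lemma compact_Ck (W : set (X -> R)) :
  closed (W : set {ptws X -> R}) ->
  (forall x, exists M, forall f, W f -> `|f x| <= M) ->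
  equicontinuous W id -> compact (Ck_subset W).
Proof.
move=> clW bW eW F PF FW.
have : precompact (W : set {family compact, X -> R}).
  apply: pointwise_precompact_equicontinuous => // x.
  have [M WM] := bW x; apply: (@precompact_subset _ _ `[- M, M]%classic).
    by move=> _ [f Wf <-] /=; rewrite in_itv /= -ler_norml; exact: WM.
  by apply: compact_precompact; [exact: Rhausdorff|exact: segment_compact].
(* On an equicontinuous set this closure is the pointwise one, and [W] is pointwise closed. *)
rewrite precompactE pointwise_compact_closure// -(closure_id _).1// => cW.
pose G : set_system (X -> R) := (fun f : continuousType X R => f : X -> R) @ F.
have [p [Wp clp]] := cW G _ FW.
have cp : continuous p by exact: (equicontinuous_continuous eW Wp).
pose q : continuousType X R := mkcts cp.
exists q; split=> // A B FA nB.
move: nB; rewrite nbhsE => -[C [[O oO OC] Cp] CB].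
(* At a continuous [p], compact-open neighborhoods are neighborhoods for uniform convergence on
   compact sets. *)
have nO : nbhs (p : {family compact, X -> R}) O.
  have : {compact-open, nbhs (p : {family compact, X -> R}) --> p}.
    by apply/compact_open_fam_compactP.
  by apply; apply: open_nbhs_nbhs; split=> //; rewrite -OC in Cp.
pose A' := [set f : X -> R | exists2 h : continuousType X R, A h & f = h].
have GA' : G A' by apply: (@filterS _ F _ A _ _ FA) => h Ah; exists h.
have [_ [[h Ah ->] Oh]] := clp A' O GA' nO.
by exists h; split=> //; apply: CB; rewrite -OC.
Qed.

End CompactCk.

Section DominatedFunctions.
Context {R : realType} {X : topologicalType} (P : X -> R) (D : X -> X -> R).

(** In the application [P x] is [q (i x)] and [D x y] is [q (i x - i y)], with [q] symmetric and
    subadditive on [L]. *)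
Definition dominated_functions : set (X -> R) :=
  [set f | (forall x, `|f x| <= P x) /\ forall x y, `|f x - f y| <= D x y].

Lemma closed_dominated_functions :
  closed (dominated_functions : set {ptws X -> R}).
Proof.
have -> : dominated_functions =
    (\bigcap_x [set f : {ptws X -> R} | `|f x| <= P x]) `&`
    (\bigcap_xy [set f : {ptws X -> R} | `|f xy.1 - f xy.2| <= D xy.1 xy.2]).
  apply/seteqP; split=> f [fP fD]; split.
  - by move=> x _; exact: fP.
  - by move=> [x y] _; exact: fD.
  - by move=> x; exact: fP.
  - by move=> x y; exact: (fD (x, y) I).
have ev x : continuous ((fun f => f x) : {ptws X -> R} -> R).
  exact: (@proj_continuous X (fun=> R) x).
apply: closedI.
  apply: closed_bigI => x _.
  apply: (@preimage_closed {ptws X -> R} R (fun f => `|f x|) [set r | r <= P x]).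
    move=> f _; apply: (@continuous_comp {ptws X -> R} R R (fun f => f x)).
      exact: ev.
    exact: norm_continuous.
  exact: closed_le.
apply: closed_bigI => -[x y] _.
apply: (@preimage_closed {ptws X -> R} R (fun f => `|f x - f y|)
  [set r | r <= D x y]).
  move=> f _; apply: (@continuous_comp {ptws X -> R} R R (fun f => f x - f y)).
    by apply: continuousB; exact: ev.
  exact: norm_continuous.
exact: closed_le.
Qed.

Lemma compact_dominated_functions :
  (forall x e, 0 < e -> \forall y \near x, D x y < e) ->
  compact (Ck_subset dominated_functions).
Proof.
move=> D0; apply: compact_Ck.
- exact: closed_dominated_functions.
- by move=> x; exists (P x) => f [].
- move=> x E /= [e /= e0 eE]; apply: filterS (D0 x e e0) => y Dxy f [_ fD].
  by apply: eE => /=; exact: le_lt_trans (fD _ _) Dxy.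
Qed.

End DominatedFunctions.

(** * From an Ascoli uniformity to a base at the origin *)

(* [decode c k] is the [k]-th member of the sequence of elements of [nat -> nat]
   coded by [c]; the coding is onto and monotone. *)
Definition decode (c : nat -> nat) (k n : nat) : nat := c (pickle (k, n)).

Lemma decode_surj (a : nat -> nat -> nat) :
  exists c, forall k n, decode c k n = a k n.
Proof.
exists (fun m => if unpickle m is Some (k, n) then a k n else 0%N) => k n.
by rewrite /decode pickleK.
Qed.

Section BaseAtOrigin.
Context {R : realType} {X : topologicalType} {L : tvsType R} {i : X -> L}.
Hypothesis freeL : free_lcs i.
Variables (B : (nat -> nat) -> set (X * X)) (C : nat -> set X).
Hypothesis nbhsX : nbhs = nbhs_ (filter_from setT B).
Hypothesis C_cover : \bigcup_n C n = setT.

(** Slot 0 of the code holds the bounds on the sets [C n]; slot [k.+1] indexes the entourage for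
    tolerance [1/(k+1)]. *)
Definition coded_functions (c : nat -> nat) : set (X -> R) :=
  [set f | (forall k x y,
              B (decode c k.+1) (x, y) -> `|f x - f y| <= k.+1%:R^-1) /\
           forall n x, C n x -> `|f x| <= (decode c 0 n)%:R].

Lemma exists_inv_le (d : R) : 0 < d -> exists k, k.+1%:R^-1 <= d.
Proof.
move=> d0; exists (Num.bound d^-1).
rewrite invf_ple ?posrE// (le_trans (ltW (archi_boundP _)))//.
  by rewrite invr_ge0 ltW.
by rewrite ler_nat.
Qed.

Lemma nbhs_polar_coded (c : nat -> nat) :
  nbhs 0 (polar i (coded_functions c) 1).
Proof.
apply: polar_nbhs => // [x|x d d0].
  have [n _ Cnx] : (\bigcup_n C n) x by rewrite C_cover.
  by exists (decode c 0 n)%:R => f [_ fC]; exact: fC.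
have [k kd] := exists_inv_le d0.
have nBx : nbhs x (xsection (B (decode c k.+1)) x).
  by rewrite nbhsX; exists (B (decode c k.+1)) => //; exists (decode c k.+1).
apply: filterS nBx => y /xsectionP Bxy f [fB _].
exact: le_trans (fB _ _ _ Bxy) kd.
Qed.

(** A larger code has smaller entourages and larger bounds, so both conditions weaken. *)
Lemma coded_functions_mono (b c : nat -> nat) :
  (forall m n, (forall k, (m k <= n k)%N) -> B n `<=` B m) ->
  (forall n, (b n <= c n)%N) -> coded_functions b `<=` coded_functions c.
Proof.
move=> Bmon bc f [fB fC]; split=> [k x y Bxy|n x Cnx].
  by apply: fB; apply: Bmon Bxy => n; exact: bc.
by rewrite (le_trans (fC _ _ Cnx))// ler_nat; exact: bc.
Qed.

(** The dominated functions are compact in [Ck R X], so the Ascoli property yields an entourage for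
    each tolerance. [P] is locally bounded by [P x + 1], hence bounded on each compact [C n]. *)
Lemma coded_functions_cofinal (P : X -> R) (D : X -> X -> R) :
  (forall n, compact (C n)) ->
  (forall K : set (Ck R X), compact K -> forall e : R, 0 < e ->
    exists2 A, filter_from setT B A & forall (f : continuousType X R) x y,
      K f -> A (x, y) -> `|f x - f y| < e) ->
  (forall x e, 0 < e -> \forall y \near x, D x y < e) ->
  (forall x y, P y <= P x + D x y) ->
  exists c, dominated_functions P D `&` [set f | continuous f] `<=`
            coded_functions c.
Proof.
move=> cC ascB D0 PD.
have /choice[a aP] : forall k, exists a, forall (f : continuousType X R) x y,
    dominated_functions P D f -> B a (x, y) -> `|f x - f y| <= k.+1%:R^-1.
  move=> k; have [|A [a _ BA] AP] :=
    ascB _ (compact_dominated_functions (P := P) D0) k.+1%:R^-1.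
    by rewrite invr_gt0.
  by exists a => f x y Kf Bxy; rewrite ltW//; apply: AP => //; exact: BA.
have /choice[b bP] : forall n, exists b, forall x, C n x -> P x <= b%:R.
  move=> n; have /compact_near_coveringP covC := cC n.
  have : \forall M \near +oo_R, C n `<=` [set x | P x <= M].
    apply: (covC _ _ (fun M x => P x <= M)) => x Cx.
    exists ([set y | D x y < 1], [set M | P x + 1 <= M]) => /=.
      by split; [exact: D0|apply: nbhs_pinfty_ge; exact: num_real].
    move=> [y M] [/= Dxy PM]; apply: le_trans PM.
    by rewrite (le_trans (PD x y))// lerD2l ltW.
  move=> /filter_ex[M CM]; exists (Num.bound `|M|) => x /CM /= /le_trans; apply.
  by rewrite (le_trans (ler_norm _))// ltW// archi_boundP.
have [c cE] := decode_surj (fun k => if k is k'.+1 then a k' else b).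
exists c => f [[fP fD] cf]; pose g : continuousType X R := mkcts cf.
split=> [k x y|n x Cnx].
  have -> : decode c k.+1 = a k by apply/funext => n; exact: cE.
  exact: (aP k g x y (conj fP fD)).
by rewrite cE (le_trans (fP _))// bP.
Qed.

End BaseAtOrigin.

Section PolarBase.
Context {R : realType} {X : topologicalType} {L : tvsType R} {i : X -> L}.
Hypothesis ci : continuous i.

(* If [p c >= 1], a Hahn-Banach functional [g <= p] with [g c = p c] restricts to
   a member of [A], so [c] is not in the polar of [A]. *)
Lemma polar_subset (V : set L) : nbhs 0 V ->
  exists (P : X -> R) (D : X -> X -> R),
  [/\ forall x e, 0 < e -> \forall y \near x, D x y < e,
      forall x y, P y <= P x + D x y &
      forall A : set (X -> R),
        dominated_functions P D `&` [set f | continuous f] `<=` A ->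
        polar i A 1 `<=` V].
Proof.
move=> nV; have [p [sp p0 pV]] := nbhs0_sublinear nV.
(* [p] need not be symmetric; its symmetrization [q] bounds [|g|] for every linear [g <= p]. *)
pose q c := Num.max (p c) (p (- c)).
have q0 e : 0 < e -> \forall c \near 0, q c < e.
  move=> e0; apply: filterS2 (p0 e e0) (nbhs0N (p0 e e0)) => c pc.
  by move=> [d pd dc]; rewrite /q gt_max pc -dc opprK.
have qN c : q (- c) = q c by rewrite /q opprK maxC.
have qD c d : q (c + d) <= q c + q d.
  rewrite /q ge_max opprD !(le_trans (sp.1 _ _))// lerD// le_max lexx ?orbT//.
have gq (g : L -> R^o) : linear g -> (forall c, g c <= p c) ->
    forall c, `|g c| <= q c.
  move=> lg gp c; have gN : - g c = g (- c).
    by rewrite -[- c]sub0r (linear_funB lg) (linear_fun0 lg) sub0r.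
  have [g0|g0] := leP 0 (g c); first by rewrite ger0_norm// le_max gp.
  by rewrite ltr0_norm// le_max gN gp orbT.
have nq (z : L) e : 0 < e -> \forall c \near z, q (z - c) < e.
  by move=> e0; exact: (nbhs0_subl z (q0 e e0)).
exists (q \o i), (fun x y => q (i x - i y)); split.
- by move=> x e e0; exact: (ci (nq (i x) e e0)).
- move=> x y; rewrite /= -[q (i x - i y)]qN opprB.
  by rewrite (le_trans _ (qD _ _))// addrCA subrr addr0.
- move=> A KA c cA; apply: pV; rewrite ltNge; apply/negP => pc.
  have [g [lg gp gc]] := hahn_banach c sp.
  (* Continuity follows from [|g| <= q], as [q] is small near 0. *)
  have cg : continuous g.
    move=> z; apply/cvgrPdist_lt => e e0.
    apply: filterS (nq z e e0) => d; apply: le_lt_trans.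
    by rewrite -(linear_funB lg); exact: gq.
  have : `|g c| < 1.
    apply: cA => //; apply: KA; split.
      split=> [x|x y] /=; first exact: gq.
      by rewrite -(linear_funB lg); exact: gq.
    by move=> x; apply: continuous_comp; [exact: ci|exact: cg].
  by rewrite gc ltNge (le_trans pc)// ler_norm.
Qed.

End PolarBase.

(** * Translation from the origin to every point, and the equivalence *)

Lemma has_G_base0 {R : numFieldType} (L : tvsType R) :
  G_base (nbhs (0 : L)) -> has_G_base L.
Proof.
move=> [N [nN Nmon]] z.
exists (fun a => [set c | N a (c - z)]); split; last first.
  by move=> a b ab c; exact: Nmon.
apply/seteqP; split=> V.
- move=> nV; have : nbhs (0 : L) [set c | V (c + z)].
    have := nbhsB (- z) nV; rewrite addNr.
    by apply: filterS => _ [v Vv <-] /=; rewrite addrC addrA subrr add0r.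
  rewrite nN => -[a _ NV]; exists a => // c /NV /=.
  by rewrite subrK.
- move=> [a _ NV].
  have nNa : nbhs (0 : L) (N a) by rewrite nN; exists a.
  apply: filterS (nbhsT z nNa) => _ [c Nc <-]; apply: NV.
  by rewrite /= addrC addKr.
Qed.

Lemma ascoli_uniformity_has_G_base (R : realType) (X : topologicalType)
    (L : tvsType R) (i : X -> L) (U : set_system (X * X)) :
  sigma_compact_space X -> free_lcs i -> ascoli_uniformity R U -> G_base U ->
  has_G_base L.
Proof.
move=> [C cC Ccov] freeL [_ nU ascU] [B [UB Bmon]].
rewrite {}UB in nU ascU; apply: has_G_base0.
exists (fun c => polar i (coded_functions (R := R) B C c) 1); split; last first.
  move=> a b ab c cb g lg cg Ag; apply: cb => //.
  exact: (coded_functions_mono Bmon ab).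
apply/seteqP; split=> V.
- have [_ ci _] := freeL.
  move=> /(polar_subset ci)[P [D [D0 PD KV]]].
  have [c Kc] := coded_functions_cofinal cC ascU D0 PD.
  by exists c => //; exact: KV.
- move=> [c _ cV]; apply: filterS cV _; exact: nbhs_polar_coded.
Qed.

Theorem theorem1p4 (R : realType) (X : topologicalType)
    (tychX : tychonoff_space X) (ascX : ascoli_space R X)
    (scX : sigma_compact_space X)
    (L : tvsType R) (i : X -> L) (freeL : free_lcs i) :
  has_G_base L <->
  exists U : set_system (X * X), ascoli_uniformity R U /\ G_base U.
Proof.
split=> [GL|[U [aU gU]]]; last first.
  exact: (ascoli_uniformity_has_G_base scX freeL aU gU).
exists (pullback_uniformity i).
by apply: G_base_ascoli_uniformity => //; exact: tychX.2.
Qed.
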